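(* It is decidable whether an avoidance set $C=\mathrm{Av}(B)$ of equivalence relations under the non-consecutive embedding order is atomic; that is, there is an algorithm which, given as input a finite set $B$ of equivalence relations on finite sets, decides whether $\mathrm{Av}(B)$ is atomic under the non-consecutive embedding order.
   Context: An equivalence relation is a pair $(X,\rho)$ where $X$ is a set and $\rho\subseteq X\times X$ is reflexive, symmetric and transitive. The non-consecutive embedding order is defined by: $(X,\rho)\le (Y,\sigma)$ if and only if there is an injective function $f:X\to Y$ such that for all $x,y\in X$, $(x,y)\in\rho$ if and only if $(f(x),f(y))\in\sigma$. Isomorphic equivalence relations are considered equal, so the equivalence relations on finite sets form a poset under $\le$; without loss of generality relations have underlying set $[n]=\{1,\dots,n\}$. For a set $B$ of elements of a poset $P$, $\mathrm{Av}(B)=\{x\in P : y\not\le x \text{ for all } y\in B\}$. A downward closed set $C$ is atomic if $C$ cannot be expressed as a union of two downward closed proper subsets of $C$. Equivalently, $C$ satisfies the joint embedding property: for all $x,y\in C$ there is $z\in C$ with $x\le z$ and $y\le z$. *)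

(* Defs.v *)
From Stdlib Require List.
From mathcomp Require Import all_boot.
From mathcomp Require Import classical_sets.

Set Implicit Arguments.
Unset Strict Implicit.
Unset Printing Implicit Defensive.

Local Open Scope classical_set_scope.

(* An equivalence relation with underlying set [n], realised as 'I_n; the
   empty relation (n = 0) is allowed. *)
Record finEquiv := FinEquiv {
  er_size : nat;
  er_graph : {set 'I_er_size * 'I_er_size};
  er_refl : reflexive [rel x y | (x, y) \in er_graph];
  er_sym : symmetric [rel x y | (x, y) \in er_graph];
  er_trans : transitive [rel x y | (x, y) \in er_graph]
}.

(* On representatives this is a preorder; two relations are isomorphic exactly
   when each embeds in the other, so downward closed sets are automatically
   closed under isomorphism and correspond to those of the quotient poset. *)
Definition embeds (E F : finEquiv) : Prop :=
  exists f : 'I_(er_size E) -> 'I_(er_size F),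
    injective f /\
    forall x y, (x, y) \in er_graph E <-> (f x, f y) \in er_graph F.

Definition Av (B : set finEquiv) : set finEquiv :=
  [set x | forall y, B y -> ~ embeds y x].

Definition downward_closed (C : set finEquiv) : Prop :=
  forall x y, C y -> embeds x y -> C x.

Definition atomic (C : set finEquiv) : Prop :=
  downward_closed C /\
  ~ exists C1 C2 : set finEquiv,
      [/\ downward_closed C1, downward_closed C2,
          C1 `<` C, C2 `<` C & C = C1 `|` C2].

(* Decidability is stated in terms of Kleene's partial recursive functions: a
   mere "exists f : T -> bool" would hold for every problem classically.  The
   argument function of RComp is a k-tuple of n-ary functions. *)
Inductive recfun : nat -> Type :=
| RZero n : recfun n
| RSucc : recfun 1
| RProj n (i : 'I_n) : recfun n
| RComp k n (g : recfun k) (h : 'I_k -> recfun n) : recfun n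
| RPrim n (g : recfun n) (h : recfun n.+2) : recfun n.+1
| RMu n (g : recfun n.+1) : recfun n.

(* [eval f v y]: f is defined at v, with value y.  Primitive recursion and
   minimisation act on the first argument, and the step function of RPrim is
   applied to the counter, the previous value and the parameters. *)
Fixpoint eval n (f : recfun n) : n.-tuple nat -> nat -> Prop :=
  match f in recfun n return n.-tuple nat -> nat -> Prop with
  | RZero _ => fun _ y => y = 0
  | RSucc => fun v y => y = (thead v).+1
  | RProj _ i => fun v y => y = tnth v i
  | RComp k _ g h => fun v y =>
      exists w : k.-tuple nat,
        (forall i, eval (h i) v (tnth w i)) /\ eval g w y
  | RPrim _ g h => fun v y =>
      (fix iter m y :=
         if m is m'.+1 then
           exists z, iter m' z /\ eval h [tuple of m' :: z :: behead v] y
         else eval g [tuple of behead v] y) (thead v) y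
  | RMu _ g => fun v y =>
      eval g [tuple of y :: v] 0 /\
      forall m, m < y -> exists z, eval g [tuple of m :: v] z.+1
  end.

Definition recursively_decidable (T : Type) (code : T -> nat)
    (P : T -> Prop) : Prop :=
  exists f : recfun 1, forall t : T,
    exists b : bool, eval f [tuple code t] b /\ (P t <-> b).

(* A relation on [n] is written down as n followed by its n x n adjacency
   matrix in row-major order, and a finite set as a list of its elements (in
   any order, possibly with repetitions); lists of numbers are turned into
   numbers by the computable bijection CodeSeq.code. *)
Definition code_finEquiv (E : finEquiv) : nat :=
  CodeSeq.code
    (er_size E ::
     [seq nat_of_bool ((x, y) \in er_graph E)
        | x <- enum 'I_(er_size E), y <- enum 'I_(er_size E)]).

Definition code_basis (B : seq finEquiv) : nat :=
  CodeSeq.code (map code_finEquiv B).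

(* Main.v *)
Require Import Defs.
From Stdlib Require List.
From mathcomp Require Import all_boot.
From mathcomp Require Import classical_sets.
From mathcomp Require Import boolp.

(** Up to isomorphism a finite equivalence relation is the partition of an
    integer into its block sizes, and embeddability is containment of Young
    diagrams: E embeds in F iff, for every a, E has at most as many blocks of
    size >= a as F.  This is a distributive lattice, in which the join
    irreducible elements are the rectangles (all blocks of the same size;
    the empty relation included).
    Hence Av(B) is atomic iff every element of B lies above a rectangle in B:
    a rectangle below a join lies below one of the joinands, and conversely a
    minimal b in B with two blocks of different sizes is the join of the two
    relations got by deleting a point from either block, both of which are in
    Av(B).  The criterion only involves bounded quantification and counting,
    so it is primitive recursive in the code of B. *)

(** * Primitive recursive functions *)

(* [v] holds the arguments; below, a bound variable is pushed on its front, so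
   the outer arguments become [behead v]. *)
Definition computes n (F : seq nat -> nat) : Prop :=
  exists f : recfun n, forall v : n.-tuple nat, eval f v (F v).

Definition computable1 (g : nat -> nat) : Prop :=
  computes 1 (fun v => g (nth 0 v 0)).

Definition computable2 (g : nat -> nat -> nat) : Prop :=
  computes 2 (fun v => g (nth 0 v 0) (nth 0 v 1)).

Lemma eq_computes n F G : F =1 G -> computes n F -> computes n G.
Proof. by move=> FG [f Ff]; exists f => v; rewrite -FG. Qed.

Lemma computes_nth n i F :
  (forall v, F v = nth 0 v i) -> i < n -> computes n F.
Proof.
move=> FE lt_in; exists (RProj (Ordinal lt_in)) => v /=.
by rewrite FE (tnth_nth 0).
Qed.

Lemma computes_comp n (G : seq nat -> nat) (Hs : seq (seq nat -> nat)) :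
    computes (size Hs) G ->
    (forall i, i < size Hs -> computes n (nth (fun=> 0) Hs i)) ->
  computes n (fun v => G [seq H v | H <- Hs]).
Proof.
move=> [g gG] hH.
(* Finite choice gathers the codes into the argument function that [RComp] expects. *)
have /fin_all_exists[h hh] : forall i : 'I_(size Hs), exists h : recfun n,
  forall v : n.-tuple nat, eval h v (nth (fun=> 0) Hs i v).
  by move=> i; apply: hH.
exists (RComp g h) => v /=.
exists (map_tuple (fun H : seq nat -> nat => H v) (in_tuple Hs)).
split; last exact: gG.
by move=> i; rewrite tnth_map (tnth_nth (fun=> 0)); apply: hh.
Qed.

Lemma computes1 g n F :
  computable1 g -> computes n F -> computes n (fun v => g (F v)).
Proof. by move=> gP FP; apply: (@computes_comp n _ [:: F]) gP _ => -[]. Qed.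

Lemma computes2 g n F G : computable2 g -> computes n F -> computes n G ->
  computes n (fun v => g (F v) (G v)).
Proof.
by move=> gP FP GP; apply: (@computes_comp n _ [:: F; G]) gP _ => -[|[]].
Qed.

(** [RPrim] recurses on the head of its tuple, so it is run on [N v :: v], and composition with
    [args] supplies this tuple from [v]. *)
Lemma computes_rec n N G (H : nat -> nat -> seq nat -> nat) :
    computes n N -> computes n G ->
    computes n.+2 (fun w => H (nth 0 w 0) (nth 0 w 1) (behead (behead w))) ->
  computes n (fun v => nat_rect (fun=> nat) (G v) (fun i z => H i z v) (N v)).
Proof.
move=> [N' NP] [g gP] [h hP].
have gP' v (t : n.-tuple nat) : tval t = v -> eval g t (G v) by move<-.
have hP' m z v (t : n.+2.-tuple nat) :
  tval t = [:: m, z & v] -> eval h t (H m z v)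
  by move=> tE; have := hP t; rewrite tE.
have primP (w : n.+1.-tuple nat) (v := behead w) : eval (RPrim g h) w
    (nat_rect (fun=> nat) (G v) (fun i z => H i z v) (thead w)).
  rewrite /=; elim: (thead w) => [|m IHm] /=; first exact: gP'.
  set z := nat_rect _ _ _ m in IHm *; exists z.
  by split; [exact: IHm | exact: hP'].
pose args (i : 'I_n.+1) := if unlift ord0 i is Some j then RProj j else N'.
exists (RComp (RPrim g h) args) => v.
exists [tuple of N v :: v]; split; last exact: primP.
move=> i; rewrite /args; case: unliftP => [j ->|->] /=; last exact: NP.
by rewrite !(tnth_nth 0).
Qed.

Lemma computes_const n c : computes n (fun=> c).
Proof.
have zeroP k : computes k (fun=> 0) by exists (RZero k).
have succP : computable1 S.
  by exists RSucc => v /=; rewrite (tuple_eta v).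
by elim: c => [|c IHc] //; apply: (@computes1 S).
Qed.

Ltac computes_var :=
  eapply computes_nth;
  [let v := fresh in move=> v; rewrite ?nth_behead; reflexivity | by []].

(** * Closure under arithmetic operations and comparisons *)

Lemma computes_succ n F : computes n F -> computes n (fun v => (F v).+1).
Proof.
by apply: computes1; exists RSucc => v /=; rewrite (tuple_eta v).
Qed.

Lemma computes_iter n g N F : computable1 g -> computes n N -> computes n F ->
  computes n (fun v => iter (N v) g (F v)).
Proof.
move=> gP NP FP.
apply: (@eq_computes _
  (fun v => nat_rect (fun=> nat) (F v) (fun _ z => g z) (N v))).
  by move=> v; elim: (N v) => //= m ->.
by apply: computes_rec => //; apply: computes1 => //; computes_var.
Qed.

Lemma computes_add n F G : computes n F -> computes n G ->
  computes n (fun v => F v + G v).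
Proof.
move=> FP GP; apply: (@eq_computes _ (fun v => iter (F v) S (G v))).
  by move=> v; elim: (F v) => //= m ->.
by apply: computes_iter => //; apply: computes_succ; computes_var.
Qed.

Lemma computes_pred n F : computes n F -> computes n (fun v => (F v).-1).
Proof.
apply: computes1; apply: (@eq_computes _
  (fun v => nat_rect (fun=> nat) 0 (fun i _ => i) (nth 0 v 0))).
  by move=> v; case: (nth 0 v 0).
by apply: computes_rec;
  [computes_var | apply: computes_const | computes_var].
Qed.

Lemma computes_sub n F G : computes n F -> computes n G ->
  computes n (fun v => F v - G v).
Proof.
move=> FP GP; apply: (@eq_computes _ (fun v => iter (G v) predn (F v))).
  by move=> v; elim: (G v) => [|m IHm] /=; rewrite ?subn0 // IHm subnS.
by apply: computes_iter => //; apply: computes_pred; computes_var.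
Qed.

Lemma computes_mul n F G : computes n F -> computes n G ->
  computes n (fun v => F v * G v).
Proof.
move=> FP GP; apply: (@eq_computes _ (fun v =>
    nat_rect (fun=> nat) 0 (fun _ z => G v + z) (F v))).
  by move=> v; elim: (F v) => //= m ->.
apply: (@computes_rec _ _ (fun=> 0) (fun _ z v => G v + z)) => //.
  exact: computes_const.
apply: computes_add; last by computes_var.
(* [G] must be evaluated behind the two variables added by the recursion: compose its code with
   projections shifted by two. *)
have [g gP] := GP.
exists (RComp g (fun i : 'I_n => RProj (lift ord0 (lift ord0 i)))) => v.
have vE : size (behead (behead v)) == n by rewrite !size_behead size_tuple.
exists (Tuple vE); split; last exact: (gP (Tuple vE)).
by move=> i /=; rewrite !(tnth_nth 0) /= !nth_behead.
Qed.

Lemma computes_not n (P : seq nat -> bool) : computes n P ->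
  computes n (fun v => ~~ P v).
Proof.
move=> PP; apply: (@eq_computes _ (fun v => 1 - P v)).
  by move=> v; case: (P v).
by apply: computes_sub => //; apply: computes_const.
Qed.

Lemma computes_and n (P Q : seq nat -> bool) : computes n P -> computes n Q ->
  computes n (fun v => P v && Q v).
Proof.
move=> PP QP; apply: (@eq_computes _ (fun v => P v * Q v)).
  by move=> v; rewrite mulnb.
exact: computes_mul.
Qed.

Lemma computes_leq n F G : computes n F -> computes n G ->
  computes n (fun v => F v <= G v).
Proof.
move=> FP GP; apply: (@eq_computes _ (fun v => 1 - (F v - G v))).
  by move=> v; rewrite /leq; case: (F v - G v).
by apply: computes_sub (computes_sub _ _ _ FP GP); apply: computes_const.
Qed.

Lemma computes_eqn n F G : computes n F -> computes n G ->
  computes n (fun v => F v == G v).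
Proof.
move=> FP GP; apply: (@eq_computes _ (fun v => (F v <= G v) && (G v <= F v))).
  by move=> v; rewrite eqn_leq.
by apply: computes_and; apply: computes_leq.
Qed.

(** * Bounded counting and bounded quantification *)

Lemma computes_count n N (P : nat -> seq nat -> bool) :
    computes n N -> computes n.+1 (fun w => P (nth 0 w 0) (behead w)) ->
  computes n (fun v => count (fun i => P i v) (iota 0 (N v))).
Proof.
move=> NP PP; apply: (@eq_computes _ (fun v =>
    nat_rect (fun=> nat) 0 (fun i z => z + P i v) (N v))).
  move=> v; elim: (N v) => // m IHm.
  by rewrite -[in RHS]addn1 iotaD count_cat /= IHm addn0 add0n.
apply: (@computes_rec _ _ (fun=> 0) (fun i z v => z + P i v)) => //.
  exact: computes_const.
apply: computes_add; first by computes_var.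
(* [skip] omits position 1, the running total, since [P] sees only the counter and the
   parameters. *)
have [p pP] := PP; pose skip (i : 'I_n.+1) : 'I_n.+2 :=
  if unlift ord0 i is Some j then lift ord0 (lift ord0 j) else ord0.
exists (RComp p (fun i => RProj (skip i))) => v.
have vE : size (nth 0 v 0 :: behead (behead v)) == n.+1.
  by rewrite /= !size_behead size_tuple.
exists (Tuple vE); split; last exact: (pP (Tuple vE)).
move=> i /=; rewrite !(tnth_nth 0) /skip.
by case: unliftP => [j|] -> /=; rewrite ?nth_behead.
Qed.

Lemma computes_all n N (P : nat -> seq nat -> bool) :
    computes n N -> computes n.+1 (fun w => P (nth 0 w 0) (behead w)) ->
  computes n (fun v => all (fun i => P i v) (iota 0 (N v))).
Proof.
move=> NP PP; apply: (@eq_computes _ (fun v =>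
    count (fun i => ~~ P i v) (iota 0 (N v)) == 0)).
  by move=> v; rewrite -leqn0 leqNgt -has_count has_predC negbK.
apply: computes_eqn (computes_const _ _).
apply: (@computes_count _ _ (fun i v => ~~ P i v)) => //.
by apply: computes_not.
Qed.

Lemma computes_has n N (P : nat -> seq nat -> bool) :
    computes n N -> computes n.+1 (fun w => P (nth 0 w 0) (behead w)) ->
  computes n (fun v => has (fun i => P i v) (iota 0 (N v))).
Proof.
move=> NP PP; apply: (@eq_computes _ (fun v =>
    0 < count (fun i => P i v) (iota 0 (N v)))).
  by move=> v; rewrite -has_count.
by apply: computes_leq (computes_const _ _) _; apply: computes_count.
Qed.

(** * Powers, quotients and the 2-adic valuation *)

Lemma count_iota_ltn m n : m <= n -> count (fun i => i < m) (iota 0 n) = m.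
Proof.
by move/(filter_iota_ltn 0)/(congr1 size); rewrite size_filter size_iota.
Qed.

Lemma computes_exp2 n F : computes n F -> computes n (fun v => 2 ^ F v).
Proof.
move=> FP; apply: (@eq_computes _ (fun v => iter (F v) (fun z => z + z) 1)).
  by move=> v; elim: (F v) => //= m ->; rewrite addnn -mul2n -expnS.
apply: computes_iter (computes_const _ _) => //.
by apply: computes_add; computes_var.
Qed.

(** The quotient of m by d counts the i < m with (i + 1) d <= m; the guard 0 < d gives the value 0
    on division by zero. *)
Lemma computes_div n F G : computes n F -> computes n G ->
  computes n (fun v => F v %/ G v).
Proof.
move=> FP GP; suff divP : computable2 divn by exact: computes2.
apply: (@eq_computes _ (fun v => count
    (fun i => (0 < nth 0 v 1) && (i.+1 * nth 0 v 1 <= nth 0 v 0))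
    (iota 0 (nth 0 v 0)))); last first.
  apply: (@computes_count _ _
    (fun i v => (0 < nth 0 v 1) && (i.+1 * nth 0 v 1 <= nth 0 v 0))).
    by computes_var.
  apply: computes_and; apply: computes_leq; try computes_var.
    exact: computes_const.
  by apply: computes_mul; [apply: computes_succ|]; computes_var.
move=> v; set m := nth 0 v 0; set d := nth 0 v 1.
case: posnP => [->|d_gt0]; first by rewrite divn0 /= count_pred0.
under eq_count => i do rewrite /= -leq_divRL // -[_ < _]/(i < m %/ d).
by rewrite count_iota_ltn ?leq_div.
Qed.

Lemma computes_dvd n F G : computes n F -> computes n G ->
  computes n (fun v => F v %| G v).
Proof.
move=> FP GP; apply: (@eq_computes _ (fun v => G v %/ F v * F v == G v)).
  by move=> v; rewrite dvdn_eq.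
by apply: computes_eqn => //; apply: computes_mul => //; apply: computes_div.
Qed.

(** The valuation of m counts the exponents k with 1 <= k < m and 2^k dividing m; the index i stands
    for k = i + 1. *)
Lemma computes_log2 n F : computes n F -> computes n (fun v => logn 2 (F v)).
Proof.
apply: (@computes1 (logn 2)).
apply: (@eq_computes _ (fun v =>
    count (fun i => 2 ^ i.+1 %| nth 0 v 0) (iota 0 (nth 0 v 0).-1))).
  move=> v; rewrite logn_count_dvd // big_add1 -sum1_count big_mkcond.
  by rewrite /index_iota subn0.
apply: (@computes_count _ _ (fun i v => 2 ^ i.+1 %| nth 0 v 0)).
  by apply: computes_pred; computes_var.
apply: computes_dvd; last by computes_var.
by apply: computes_exp2; apply: computes_succ; computes_var.
Qed.

Ltac computability :=
  first
  [ exact: computes_const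
  | by computes_var
  | assumption
  | match goal with H : forall _, _ |- _ => apply: (H); computability end
  | apply: computes_succ; computability
  | apply: computes_pred; computability
  | apply: computes_exp2; computability
  | apply: computes_log2; computability
  | apply: computes_add; computability
  | apply: computes_sub; computability
  | apply: computes_mul; computability
  | apply: computes_div; computability
  | apply: computes_not; computability
  | apply: computes_and; computability
  | apply: computes_eqn; computability
  | apply: computes_leq; computability
  | apply: computes_dvd; computability
  | apply: computes_count; computability
  | apply: computes_all; computability
  | apply: computes_has; computability
  ].

(** * Decoding lists *)

(** [CodeSeq.code (n :: s)] is 2^n (2 c + 1) with c the code of s, so its 2-adic valuation is the
    head. *)
Definition code_head c := logn 2 c.
(* (2 ^ n * (2 * m + 1)) %/ 2 ^ n.+1 = m *)
Definition code_tail c := c %/ 2 ^ (logn 2 c).+1.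
Definition code_nth c i := code_head (iter i code_tail c).
(** Only the empty list has code 0, so the nonzero iterated tails are counted; the code itself
    bounds the length. *)
Definition code_size c := count (fun i => 0 < iter i code_tail c) (iota 0 c).

Lemma code_head_cons n s : code_head (CodeSeq.code (n :: s)) = n.
Proof.
rewrite /code_head /= lognM ?expn_gt0 // pfactorK //.
by rewrite lognE dvdn2 /= odd_double addn0.
Qed.

Lemma code_tail_cons n s : code_tail (CodeSeq.code (n :: s)) = CodeSeq.code s.
Proof.
rewrite /code_tail -/(code_head _) code_head_cons /= expnSr divnMl ?expn_gt0 //.
by rewrite divn2 /= uphalf_double.
Qed.

Lemma iter_code_tail s i :
  iter i code_tail (CodeSeq.code s) = CodeSeq.code (drop i s).
Proof.
elim: i s => [|i IHi] s; first by rewrite drop0.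
rewrite iterSr; case: s => [|n s]; last by rewrite code_tail_cons IHi.
by rewrite /code_tail div0n (IHi [::]).
Qed.

Lemma code_nthE s i : code_nth (CodeSeq.code s) i = nth 0 s i.
Proof.
rewrite /code_nth iter_code_tail -[i in RHS]addn0 -nth_drop.
(* Past the end the tail has code 0, whose valuation is 0, the default of [nth]. *)
by case: (drop i s) => [|n t]; rewrite ?code_head_cons // /code_head logn0.
Qed.

Lemma code_gt0 s : (0 < CodeSeq.code s) = (0 < size s).
Proof. by case: s => //= n s; rewrite muln_gt0 expn_gt0. Qed.

Lemma size_code s : size s <= CodeSeq.code s.
Proof.
elim: s => //= n s IHs; apply: (@leq_trans (CodeSeq.code s).*2.+1);
  last by rewrite leq_pmull ?expn_gt0.
by rewrite ltnS (leq_trans IHs) // -addnn leq_addr.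
Qed.

Lemma code_sizeE s : code_size (CodeSeq.code s) = size s.
Proof.
rewrite /code_size; under eq_count => i do
  rewrite /= iter_code_tail code_gt0 size_drop subn_gt0.
by rewrite count_iota_ltn ?size_code.
Qed.

(** * Blocks of an equivalence relation *)

Lemma card_count_enum (T : finType) (P : pred T) :
  #|[set x | P x]| = count P (enum T).
Proof.
rewrite cardsE cardE -size_filter /enum_mem -enumT -filter_predI.
by congr size; apply: eq_filter => x; rewrite /= andbT.
Qed.

Lemma card_ord_count n (P : pred nat) :
  #|[set i : 'I_n | P i]| = count P (iota 0 n).
Proof. by rewrite card_count_enum -val_enum_ord count_map. Qed.

Definition er_rel E : rel 'I_(er_size E) := [rel x y | (x, y) \in er_graph E].
Arguments er_rel : clear implicits.

Definition er_class E x : {set 'I_(er_size E)} := [set y | er_rel E x y].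
Arguments er_class : clear implicits.

(* Blocks are represented by their least elements. *)
Definition er_min E (x : 'I_(er_size E)) :=
  [forall y : 'I_(er_size E), (y < x) ==> ~~ er_rel E x y].
Arguments er_min : clear implicits.

(** As a function of a > 0 this is the conjugate of the partition into block sizes. *)
Definition er_blocks E a :=
  #|[set x | er_min E x & a <= #|er_class E x|]|.

Definition er_rep E (x : 'I_(er_size E)) : 'I_(er_size E) :=
  [arg min_(y < x | er_rel E x y) (y : nat)].
Arguments er_rep : clear implicits.

Definition er_rect E := forall x y, #|er_class E x| = #|er_class E y|.

Section Blocks.
Variable E : finEquiv.
Implicit Types x y : 'I_(er_size E).

Lemma er_relxx x : er_rel E x x.
Proof. exact: er_refl. Qed.

Lemma er_relC x y : er_rel E x y = er_rel E y x.
Proof. exact: er_sym. Qed.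

Lemma er_rel_trans : transitive (er_rel E).
Proof. exact: er_trans. Qed.

Lemma er_class_eq x y : er_rel E x y -> er_class E x = er_class E y.
Proof.
move=> xy; apply/setP => z; rewrite !inE.
apply/idP/idP; last exact: er_rel_trans.
by apply: er_rel_trans; rewrite er_relC.
Qed.

Lemma er_rep_rel x : er_rel E x (er_rep E x).
Proof. by rewrite /er_rep; case: arg_minnP => //; apply: er_relxx. Qed.

Lemma er_rep_min x : er_min E (er_rep E x).
Proof.
rewrite /er_rep; case: arg_minnP => [|y xy min_y]; first exact: er_relxx.
apply/forallP => z; apply/implyP => lt_zy; apply/negP => yz.
by have := min_y z (er_rel_trans _ _ _ xy yz); rewrite leqNgt lt_zy.
Qed.

Lemma er_min_inj x y : er_min E x -> er_min E y -> er_rel E x y -> x = y.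
Proof.
move=> /forallP/(_ y) + /forallP/(_ x) => + + xy.
rewrite (er_relC y) xy !implybF -!leqNgt => le_xy le_yx.
by apply/val_inj/eqP; rewrite eqn_leq le_xy.
Qed.

Lemma er_rep_eq x y : (er_rep E x == er_rep E y) = er_rel E x y.
Proof.
apply/eqP/idP => [rxy|xy].
  by apply: er_rel_trans (er_rep_rel x) _; rewrite rxy er_relC er_rep_rel.
apply: er_min_inj; rewrite ?er_rep_min //.
apply: er_rel_trans (er_rep_rel y); apply: er_rel_trans xy.
by rewrite er_relC er_rep_rel.
Qed.

(** The nonempty fibres of [f] are the blocks, and [f] is injective on their least elements; a > 0
    excludes the empty fibres. *)
Lemma er_blocks_kernel (U : finType) (f : 'I_(er_size E) -> U) a :
    (forall x y, er_rel E x y = (f x == f y)) -> 0 < a ->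
  er_blocks E a = #|[set u | a <= #|f @^-1: [set u]|]|.
Proof.
move=> fP a_gt0.
have fibE x : f @^-1: [set f x] = er_class E x.
  by apply/setP => y; rewrite !inE fP eq_sym.
rewrite /er_blocks -(card_in_imset (f := f)) => [|x y]; last first.
  by rewrite !inE => /andP[mx _] /andP[my _] /eqP;
    rewrite -fP; apply: er_min_inj.
congr #|pred_of_set _|; apply/setP => u; rewrite inE.
apply/imsetP/idP => [[x + ->]|a_le]; first by rewrite inE fibE => /andP[].
have /card_gt0P[x] := leq_trans a_gt0 a_le; rewrite !inE => /eqP uE.
exists (er_rep E x); last by apply/eqP; rewrite -uE -fP er_rep_rel.
by rewrite inE er_rep_min -(er_class_eq _ _ (er_rep_rel x)) -fibE uE.
Qed.

Lemma leq_er_blocks a b : a <= b -> er_blocks E b <= er_blocks E a.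
Proof.
move=> le_ab; apply/subset_leq_card/fintype.subsetP => x.
rewrite !inE => /andP[->]; exact: leq_trans.
Qed.

Lemma er_blocks_le_size a : er_blocks E a <= er_size E.
Proof. by rewrite -[leqRHS]card_ord max_card. Qed.

Lemma er_blocks_eq0 a :
  (forall x, #|er_class E x| < a) -> er_blocks E a = 0.
Proof.
move=> lt_a; apply: eq_card0 => x; rewrite !inE.
by rewrite [_ <= _]leqNgt lt_a andbF.
Qed.

Lemma er_blocks_gt_size a : er_size E < a -> er_blocks E a = 0.
Proof.
move=> lt_a; apply: er_blocks_eq0 => x; apply: leq_ltn_trans lt_a.
by rewrite -[leqRHS]card_ord max_card.
Qed.

End Blocks.

(** * Embeddability as comparison of block counts *)

(** The entries >= a form an initial segment of a decreasing list; as a > 0, the default 0 past the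
    end is not among them. *)
Lemma count_sorted_geq l a i : 0 < a -> sorted geq l ->
  (a <= nth 0 l i) = (i < count (leq a) l).
Proof.
move=> a_gt0; elim: l i => [|x l IHl] i lP.
  by rewrite nth_nil leqNgt a_gt0.
have /allP lx : all (geq x) l.
  by apply: order_path_min lP => ? ? ? /= h1 h2; apply: leq_trans h2 h1.
case: (leqP a x) => [ax|xa].
  by rewrite /= ax; case: i => [|i]; rewrite //= IHl ?(path_sorted lP).
have l0 : count (leq a) l = 0.
  apply/eqP; rewrite -leqn0 leqNgt -has_count; apply/hasPn => y /lx /= yx.
  by rewrite -ltnNge (leq_ltn_trans yx).
rewrite /= l0 (ltn_geF xa) ltn0; case: i => [|i] /=; first by rewrite ltn_geF.
by rewrite IHl ?(path_sorted lP) // l0.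
Qed.

(* Match the elements of S and T in order of decreasing weight. *)
Lemma injective_matching (S T : finType) (s : S -> nat) (t : T -> nat)
    (y0 : T) :
    (forall a, 0 < a -> #|[set x | a <= s x]| <= #|[set y | a <= t y]|) ->
  exists g : S -> T,
    {in [pred x | 0 < s x] &, injective g} /\ forall x, s x <= t (g x).
Proof.
move=> le_st.
pose dec (R : finType) (r : R -> nat) := sort (relpre r geq) (enum R).
have decS (R : finType) (r : R -> nat) : sorted geq (map r (dec R r)).
  by rewrite sorted_map; apply: sort_sorted => x y; apply: leq_total.
have decC (R : finType) (r : R -> nat) a :
    count (leq a) (map r (dec R r)) = #|[set x | a <= r x]|.
  by rewrite count_map /dec (permP (permEl (perm_sort _ _))) card_count_enum.
have mem_dec x : x \in dec S s by rewrite mem_sort mem_enum.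
pose i x := index x (dec S s).
have nth_i x : nth 0 (map s (dec S s)) (i x) = s x.
  by rewrite (nth_map x) ?nth_index // index_mem.
(* The rank of x is below the number of elements of S of weight >= [s x], hence below the same
   number for T. *)
have i_lt x : 0 < s x -> i x < #|[set y | s x <= t y]|.
  move=> sx; apply: leq_trans (le_st _ sx).
  by rewrite -decC -count_sorted_geq // nth_i.
have i_size x : 0 < s x -> i x < size (dec T t).
  by move=> /i_lt/leq_trans-> //; rewrite size_sort -cardT max_card.
(* Send x to the element of T of equal rank; the default [y0] is reached only when x has weight
   0. *)
exists (fun x => nth y0 (dec T t) (i x)); split=> [x y sx sy|x].
  move/eqP; rewrite nth_uniq ?i_size ?sort_uniq ?enum_uniq // => /eqP ixy.
  by rewrite -[x](nth_index x (mem_dec x)) -[y](nth_index x (mem_dec y))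
             -/(i x) ixy.
case: (posnP (s x)) => [-> //|sx].
by rewrite -(nth_map y0 0) ?i_size // count_sorted_geq // decC i_lt.
Qed.

(** The size of a block is carried by its least element alone, so that matching points of positive
    weight matches blocks. *)
Definition er_weight E x := if er_min E x then #|er_class E x| else 0.
Arguments er_weight : clear implicits.

Lemma card_er_weight E a : 0 < a ->
  #|[set x | a <= er_weight E x]| = er_blocks E a.
Proof.
move=> a_gt0; apply: eq_card => x; rewrite !inE /er_weight.
by case: ifP => // _; rewrite leqNgt a_gt0.
Qed.

(** An embedding induces an injection on blocks that never decreases their size. *)
Lemma embeds_blocks E F : embeds E F ->
  forall a, er_blocks E a <= er_blocks F a.
Proof.
case=> f [f_inj fP] a.
have fE x y : er_rel F (f x) (f y) = er_rel E x y by apply/idP/idP => /fP.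
pose g x := er_rep F (f x).
rewrite /er_blocks -(card_in_imset (f := g)) => [|x y]; last first.
  rewrite !inE => /andP[mx _] /andP[my _] /eqP.
  by rewrite er_rep_eq fE; apply: er_min_inj.
apply/subset_leq_card/fintype.subsetP => _ /imsetP[x + ->].
rewrite !inE er_rep_min => /andP[_ /leq_trans->] //.
rewrite -(er_class_eq _ _ _ (er_rep_rel _ (f x))) -(card_imset _ f_inj).
by apply/subset_leq_card/fintype.subsetP => _ /imsetP[y + ->]; rewrite !inE fE.
Qed.

(** Match the blocks injectively with blocks at least as large, then map each block into its
    partner. *)
Lemma blocks_embeds E F :
  (forall a, 0 < a -> er_blocks E a <= er_blocks F a) -> embeds E F.
Proof.
move=> le_EF.
(* The matching needs a default point of F. If F is empty, the counts at a = 1 show that E is empty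
   as well. *)
case: (pickP 'I_(er_size F)) => [y0 _|F0]; last first.
  have E0 (x : 'I_(er_size E)) : False.
    suff /card_gt0P[y _] : 0 < er_blocks F 1 by have := F0 y.
    apply: leq_trans (le_EF 1 isT); apply/card_gt0P; exists (er_rep E x).
    rewrite inE er_rep_min; apply/card_gt0P; exists (er_rep E x).
    by rewrite inE er_relxx.
  exists (fun x => False_rect _ (E0 x)).
  by split=> x; case: (E0 x).
have [a a_gt0|g [g_inj gP]] :=
    injective_matching _ _ (er_weight E) (er_weight F) y0.
  by rewrite !card_er_weight ?le_EF.
have class_gt0 x : 0 < #|er_class E x|.
  by apply/card_gt0P; exists x; rewrite inE er_relxx.
have weight_rep x : er_weight E (er_rep E x) = #|er_class E x|.
  by rewrite /er_weight er_rep_min -(er_class_eq _ _ _ (er_rep_rel _ x)).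
have g_min x : er_min F (g (er_rep E x)).
  have := gP (er_rep E x); rewrite weight_rep /(er_weight F).
  by case: ifP => // _; rewrite leqNgt class_gt0.
have le_class x : #|er_class E x| <= #|er_class F (g (er_rep E x))|.
  by rewrite -weight_rep (leq_trans (gP _)) // /er_weight g_min.
pose i x := index x (enum (er_class E x)).
have mem_class x : x \in enum (er_class E x) by rewrite mem_enum inE er_relxx.
have i_lt x : i x < #|er_class F (g (er_rep E x))|.
  by apply: leq_trans (le_class x); rewrite cardE index_mem.
(* [f x] has the same position in the matched block as x has in its own. *)
pose f x := nth y0 (enum (er_class F (g (er_rep E x)))) (i x).
have f_rel x : er_rel F (g (er_rep E x)) (f x).
  have : f x \in enum (er_class F (g (er_rep E x))).
    by rewrite mem_nth // -cardE.
  by rewrite mem_enum inE.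
have fE x y : er_rel F (f x) (f y) = er_rel E x y.
  rewrite -[RHS]er_rep_eq; apply/idP/idP => [fxy|/eqP rxy].
    apply/eqP; apply: g_inj; rewrite ?inE ?weight_rep //.
    apply: er_min_inj => //.
    apply: er_rel_trans (f_rel x) _; apply: er_rel_trans fxy _.
    by rewrite er_relC.
  apply: er_rel_trans (f_rel y); rewrite -rxy er_relC; exact: f_rel.
exists f; split=> [x y fxy|x y]; last first.
  by split; have := fE x y; rewrite /er_rel /= => ->.
have xy : er_rel E x y by rewrite -fE fxy er_relxx.
have rxy : er_rep E x = er_rep E y by apply/eqP; rewrite er_rep_eq.
move: fxy; rewrite /f rxy => /eqP.
rewrite nth_uniq ?enum_uniq -?cardE ?i_lt // -?rxy ?i_lt // => /eqP.
rewrite /i -(er_class_eq _ _ _ xy) => ixy.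
have my : y \in enum (er_class E x) by rewrite (er_class_eq _ _ _ xy).
by rewrite -[x](nth_index x (mem_class x)) -[y](nth_index x my) ixy.
Qed.

(** * Constructing relations with prescribed block sizes *)

Definition kernel_graph {T : finType} {U : eqType} (f : T -> U) :
    {set 'I_#|T| * 'I_#|T|} :=
  [set p | f (enum_val p.1) == f (enum_val p.2)]%SET.

Lemma kernel_graph_refl {T : finType} {U : eqType} (f : T -> U) :
  reflexive [rel x y | (x, y) \in kernel_graph f].
Proof. by move=> x; rewrite /= inE. Qed.

Lemma kernel_graph_sym {T : finType} {U : eqType} (f : T -> U) :
  symmetric [rel x y | (x, y) \in kernel_graph f].
Proof. by move=> x y; rewrite /= !inE eq_sym. Qed.

Lemma kernel_graph_trans {T : finType} {U : eqType} (f : T -> U) :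
  transitive [rel x y | (x, y) \in kernel_graph f].
Proof. by move=> y x z; rewrite /= !inE => /eqP->. Qed.

Definition kernel_equiv {T : finType} {U : eqType} (f : T -> U) : finEquiv :=
  FinEquiv (@kernel_graph_refl T U f) (@kernel_graph_sym T U f)
    (@kernel_graph_trans T U f).

Lemma kernel_equiv_blocks (T U : finType) (f : T -> U) a : 0 < a ->
  er_blocks (kernel_equiv f) a = #|[set u | a <= #|f @^-1: [set u]|]%SET|.
Proof.
move=> a_gt0.
rewrite (@er_blocks_kernel (kernel_equiv f) U (fun x => f (enum_val x))) //;
  last first.
  by move=> x y; rewrite /er_rel /= inE.
apply: eq_card => u; rewrite !inE; congr (_ <= _).
rewrite -(@on_card_preimset _ _ (@enum_val T T));
  last exact: onW_bij (@enum_val_bij T).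
by apply: eq_card => x; rewrite !inE.
Qed.

(* The relation with block sizes [d i]; empty blocks are allowed here, hence
   [0 < a]. *)
Lemma sizes_equiv_blocks M (d : 'I_M -> nat) a : 0 < a ->
  er_blocks (kernel_equiv (fun p : {i : 'I_M & 'I_(d i)} => tag p)) a =
  #|[set i | a <= d i]%SET|.
Proof.
move=> a_gt0; rewrite kernel_equiv_blocks //.
apply: eq_card => i; rewrite !inE; congr (_ <= _).
rewrite -[RHS]card_ord -cardsT.
rewrite -(card_imset (f := Tagged (fun i => 'I_(d i)) (i := i))); last first.
  by move=> k k' /eqP; rewrite eq_Tagged => /eqP.
apply: eq_card => -[j k]; rewrite !inE /=.
apply/eqP/imsetP => [ji|[k' _ /(congr1 tag)]] //.
by case: _ / ji; exists k.
Qed.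

(* The join takes the maxima of the decreasingly sorted block sizes. *)
Lemma equiv_join E F : exists G, forall a, 0 < a ->
  er_blocks G a = maxn (er_blocks E a) (er_blocks F a).
Proof.
(* [dec X] lists the block sizes in decreasing order, padded with zeros from the points that are not
   least in their block. *)
pose dec X := sort geq [seq er_weight X x | x <- enum 'I_(er_size X)].
have decP X a i : 0 < a -> (a <= nth 0 (dec X) i) = (i < er_blocks X a).
  move=> a_gt0; rewrite count_sorted_geq //; last first.
    by apply: sort_sorted => x y; apply: leq_total.
  rewrite (permP (permEl (perm_sort _ _))) count_map.
  by rewrite -card_er_weight // card_count_enum.
(* Enough indices for the blocks of either relation; surplus indices give empty blocks. *)
pose M := er_size E + er_size F.
pose d (i : 'I_M) := maxn (nth 0 (dec E) i) (nth 0 (dec F) i).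
exists (kernel_equiv (fun p : {i : 'I_M & 'I_(d i)} => tag p)) => a a_gt0.
rewrite sizes_equiv_blocks //.
rewrite -[RHS](@count_iota_ltn _ M); last first.
  by rewrite geq_max !(leq_trans (er_blocks_le_size _ _)) ?leq_addl ?leq_addr.
rewrite -card_ord_count; apply: eq_card => i.
by rewrite !inE !leq_max !decP.
Qed.

(** * The embedding preorder, and rectangles below joins *)

Lemma embeds_refl E : embeds E E.
Proof. by exists id; split=> // x y. Qed.

Lemma embeds_trans F E G : embeds E F -> embeds F G -> embeds E G.
Proof.
move=> [f [f_inj fP]] [g [g_inj gP]]; exists (g \o f).
by split=> [|x y]; [exact: inj_comp | rewrite fP gP].
Qed.

(** A rectangle with blocks of size s embeds wherever there are enough blocks of size >= s, and the
    maximum at this single s is attained by E or by F. *)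
Lemma embeds_rect_join R E F G :
    er_rect R ->
    (forall a, 0 < a ->
      er_blocks G a = maxn (er_blocks E a) (er_blocks F a)) ->
  embeds R G -> embeds R E \/ embeds R F.
Proof.
move=> rectR GP RG.
case: (pickP 'I_(er_size R)) => [x0 _|R0]; last first.
  left; apply: blocks_embeds => a _; rewrite er_blocks_eq0 // => x.
  by have := R0 x.
pose s := #|er_class R x0|.
have s_gt0 : 0 < s by apply/card_gt0P; exists x0; rewrite inE er_relxx.
have rect_embeds X : er_blocks R s <= er_blocks X s -> embeds R X.
  move=> le_s; apply: blocks_embeds => a a_gt0.
  case: (leqP a s) => [le_as|lt_sa].
    apply: leq_trans (leq_er_blocks _ _ _ le_as); apply: leq_trans le_s.
    apply/subset_leq_card/fintype.subsetP => x; rewrite !inE => /andP[-> _] /=.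
    by rewrite (rectR x x0).
  by rewrite er_blocks_eq0 // => x; rewrite (rectR x x0).
have := embeds_blocks _ _ RG s; rewrite GP // leq_max.
by case/orP=> /rect_embeds; [left | right].
Qed.

(** * Deleting a point *)

(** The restriction of E to the points other than p, with blocks still labelled by representatives
    in E; a label may be p itself. *)
Definition er_del {E} (p : 'I_(er_size E)) : finEquiv :=
  kernel_equiv (fun x : {x | x != p} => er_rep E (val x)).
Arguments er_del : clear implicits.

Lemma er_del_embeds E p : embeds (er_del E p) E.
Proof.
exists (fun x => val (enum_val x)); split.
  exact: inj_comp val_inj (@enum_val_inj _ _).
by move=> x y; rewrite inE er_rep_eq.
Qed.

Lemma er_size_del E p : er_size (er_del E p) < er_size E.
Proof.
rewrite /= card_sig cardC1 card_ord.
by case: (er_size E) p => [[]|].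
Qed.

(** Only the block of p shrinks, and by one point, so only the count at its original size can
    drop. *)
Lemma er_blocks_del E p a : 0 < a -> a != #|er_class E p| ->
  er_blocks E a <= er_blocks (er_del E p) a.
Proof.
move=> a_gt0 a_neq; rewrite kernel_equiv_blocks //.
rewrite (@er_blocks_kernel E _ (er_rep E)) //;
  last by move=> x y; rewrite er_rep_eq.
apply/subset_leq_card/fintype.subsetP => u; rewrite !inE => le_a.
rewrite -(card_imset _ val_inj).
rewrite (_ : _ @: _ = (er_rep E @^-1: [set u] :\ p)%SET); last first.
  apply/setP => x; rewrite !inE; apply/imsetP/andP => [[[y yp] yu ->]|[xp xu]].
    by move: yu; rewrite !inE.
  by exists (exist _ x xp); rewrite ?inE.
have := cardsD1 p (er_rep E @^-1: [set u]);
case: (boolP (p \in _)) => [pu cE|_]; last by rewrite add0n => <-.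
have uE : (er_rep E @^-1: [set u])%SET = er_class E p.
  move: pu; rewrite !inE => /eqP <-; apply/setP => x.
  by rewrite !inE er_rep_eq er_relC.
rewrite uE in cE le_a *.
have : a < #|er_class E p| by rewrite ltn_neqAle a_neq.
by rewrite cE add1n ltnS.
Qed.

(** * Atomic avoidance sets *)

Lemma embeds_size E F : embeds E F -> er_size E <= er_size F.
Proof. by case=> f [/leq_card]; rewrite !card_ord. Qed.

Lemma Av_downward_closed B : downward_closed (Av B).
Proof.
by move=> x y Cy xy b Bb bx; apply: Cy Bb (embeds_trans _ _ _ bx xy).
Qed.

(** Given x outside [C1] and y outside [C2], their join avoids B: an element of B below it would put
    a rectangle of B below x or y. The join then lies in neither part. *)
Lemma atomic_of_rect (B : set finEquiv) :
    (forall b, B b -> exists r, [/\ B r, er_rect r & embeds r b]) ->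
  atomic (Av B).
Proof.
move=> rectB; split; first exact: Av_downward_closed.
case=> C1 [C2] [C1d C2d [C1C nC1] [C2C nC2] CE].
have /existsNP[x /not_implyP[Cx nC1x]] := nC1.
have /existsNP[y /not_implyP[Cy nC2y]] := nC2.
have [z zP] := equiv_join x y.
have xz : embeds x z.
  by apply: blocks_embeds => a a_gt0; rewrite zP // leq_maxl.
have yz : embeds y z.
  by apply: blocks_embeds => a a_gt0; rewrite zP // leq_maxr.
suff Cz : Av B z.
  move: Cz; rewrite CE => -[C1z|C2z]; first exact: nC1x (C1d _ _ C1z xz).
  exact: nC2y (C2d _ _ C2z yz).
move=> b Bb bz; have [r [Br rect_r rb]] := rectB b Bb.
have [rx|ry] := embeds_rect_join _ _ _ _ rect_r zP (embeds_trans _ _ _ rb bz).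
  exact: Cx Br rx.
exact: Cy Br ry.
Qed.

(** The two deletions lower the count at different values of a, so for each a one of them retains
    the count of E. *)
Lemma embeds_of_del E G p q : #|er_class E p| != #|er_class E q| ->
  embeds (er_del E p) G -> embeds (er_del E q) G -> embeds E G.
Proof.
move=> neq_pq pG qG; apply: blocks_embeds => a a_gt0.
have [ap|nap] := eqVneq a #|er_class E p|.
  apply: leq_trans (embeds_blocks _ _ qG a); apply: er_blocks_del => //.
  by rewrite ap.
exact: leq_trans (er_blocks_del _ _ _ a_gt0 nap) (embeds_blocks _ _ pG a).
Qed.

(** Descend to an element of B with no smaller element of B below it. If it had blocks of different
    sizes, deleting a point from each would split [Av B]. *)
Lemma rect_of_atomic (B : set finEquiv) : atomic (Av B) ->
  forall b, B b -> exists r, [/\ B r, er_rect r & embeds r b].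
Proof.
case=> _ irr b; have [n] := ubnP (er_size b); elim: n b => // n IHn b.
rewrite ltnS => le_bn Bb.
have [[c [Bc cb lt_cb]]|min_b] :=
    pselect (exists c, [/\ B c, embeds c b & er_size c < er_size b]).
  have [r [Br rect_r rc]] := IHn c (leq_trans lt_cb le_bn) Bc.
  by exists r; split=> //; apply: embeds_trans rc cb.
exists b; split=> //; last exact: embeds_refl.
move=> p q; apply/eqP/negPn/negP => neq_pq; apply: irr.
have C_del s : Av B (er_del b s).
  move=> c Bc cs; apply: min_b; exists c; split=> //.
    exact: embeds_trans cs (er_del_embeds _ _).
  exact: leq_ltn_trans (embeds_size _ _ cs) (er_size_del _ _).
(* Each part omits one deletion of b, which is in [Av B] by minimality. They cover [Av B], since a
   relation above both deletions is above b. *)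
exists [set z | Av B z /\ ~ embeds (er_del b p) z]%classic.
exists [set z | Av B z /\ ~ embeds (er_del b q) z]%classic.
have down s :
    downward_closed [set z | Av B z /\ ~ embeds (er_del b s) z]%classic.
  move=> x y [Cy nsy] xy; split; first exact: Av_downward_closed Cy xy.
  by move=> sx; apply: nsy; apply: embeds_trans sx xy.
have proper s : ([set z | Av B z /\ ~ embeds (er_del b s) z] `<` Av B)%classic.
  split=> [z []//|/(_ _ (C_del s))[_]]; apply; exact: embeds_refl.
split=> //; apply/seteqP; split=> [z Cz|z [] []//].
have [pz|npz] := pselect (embeds (er_del b p) z); last by left.
right; split=> // qz; apply: Cz Bb _; exact: embeds_of_del neq_pq pz qz.
Qed.

(** * The decision procedure *)

(** Row-major matrix entry; the successor skips the leading size. *)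
Definition code_rel e x y := 0 < code_nth e (x * code_head e + y).+1.
Definition code_class e x := count (code_rel e x) (iota 0 (code_head e)).
Definition code_min e x := all (fun y => ~~ code_rel e x y) (iota 0 x).
Definition code_blocks e a :=
  count (fun x => code_min e x && (a <= code_class e x)) (iota 0 (code_head e)).
Definition code_rect e :=
  all (fun x => all (fun y => code_class e x == code_class e y)
    (iota 0 (code_head e))) (iota 0 (code_head e)).
(** Thresholds up to the size of the first relation suffice, as its counts vanish beyond. *)
Definition code_le e f :=
  all (fun a => code_blocks e a <= code_blocks f a) (iota 0 (code_head e).+1).
Definition code_decide c :=
  all (fun i => has (fun j =>
    code_rect (code_nth c j) && code_le (code_nth c j) (code_nth c i))
    (iota 0 (code_size c))) (iota 0 (code_size c)).

Lemma computable_decide : computable1 code_decide.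
Proof.
have headP n F : computes n F -> computes n (fun v => code_head (F v)).
  exact: computes_log2.
have tailP : computable1 code_tail.
  by rewrite /computable1 /code_tail; computability.
have iterP n F G : computes n F -> computes n G ->
  computes n (fun v => iter (F v) code_tail (G v)) by exact: computes_iter.
have nthP n F G : computes n F -> computes n G ->
  computes n (fun v => code_nth (F v) (G v)).
  by move=> *; rewrite /code_nth; computability.
(* A quantifier body has one more variable than its context, so functions with bounded quantifiers
   are first treated at their own arity and then composed. *)
have sizeP n F : computes n F -> computes n (fun v => code_size (F v)).
  by apply: (@computes1 code_size);
    rewrite /computable1 /code_size; computability.
have relP n F G H : computes n F -> computes n G -> computes n H ->
    computes n (fun v => code_rel (F v) (G v) (H v)).
  by move=> *; rewrite /code_rel; computability.
have classP n F G : computes n F -> computes n G ->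
    computes n (fun v => code_class (F v) (G v)).
  by apply: (@computes2 code_class);
    rewrite /computable2 /code_class; computability.
have minP n F G : computes n F -> computes n G ->
    computes n (fun v => code_min (F v) (G v)).
  by apply: (@computes2 code_min);
    rewrite /computable2 /code_min; computability.
have blocksP n F G : computes n F -> computes n G ->
    computes n (fun v => code_blocks (F v) (G v)).
  by apply: (@computes2 code_blocks);
    rewrite /computable2 /code_blocks; computability.
have rectP n F : computes n F -> computes n (fun v => code_rect (F v)).
  by apply: (@computes1 code_rect);
    rewrite /computable1 /code_rect; computability.
have leP n F G : computes n F -> computes n G ->
    computes n (fun v => code_le (F v) (G v)).
  by apply: (@computes2 code_le);
    rewrite /computable2 /code_le; computability.
by rewrite /computable1 /code_decide; computability.
Qed.

(** * Correctness of the decision procedure on codes *)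

Lemma nth_allpairs (R S T : Type) (f : R -> S -> T) r s x0 y0 z0 i j :
    i < size r -> j < size s ->
  nth z0 [seq f x y | x <- r, y <- s] (i * size s + j) =
  f (nth x0 r i) (nth y0 s j).
Proof.
elim: r i => //= x r IHr [|i] ir js; rewrite nth_cat size_map.
  by rewrite mul0n js (nth_map y0).
by rewrite mulSn -addnA ltnNge leq_addr addKn IHr.
Qed.

Section CodeFinEquiv.
Variable E : finEquiv.
Notation e := (code_finEquiv E).
Implicit Types x y : 'I_(er_size E).

Lemma code_head_finEquiv : code_head e = er_size E.
Proof. exact: code_head_cons. Qed.

Lemma code_rel_finEquiv x y : code_rel e x y = er_rel E x y.
Proof.
rewrite /code_rel code_head_finEquiv code_nthE /=.
have := nth_allpairs _ _ _ (fun x y => nat_of_bool ((x, y) \in er_graph E))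
  (enum 'I_(er_size E)) (enum 'I_(er_size E)) x y 0 x y.
rewrite !size_enum_ord !nth_ord_enum => -> //.
by rewrite lt0b.
Qed.

Lemma code_class_finEquiv x : code_class e x = #|er_class E x|.
Proof.
rewrite /code_class code_head_finEquiv -card_ord_count.
by apply: eq_card => y; rewrite !inE code_rel_finEquiv.
Qed.

Lemma code_min_finEquiv x : code_min e x = er_min E x.
Proof.
apply/allP/forallP => [xP y|xP i].
  by apply/implyP => yx; rewrite -code_rel_finEquiv xP // mem_iota.
rewrite mem_iota add0n => /= ix; have iE := ltn_trans ix (ltn_ord x).
have := xP (Ordinal iE); rewrite /= ix -code_rel_finEquiv; exact.
Qed.

Lemma code_blocks_finEquiv a : code_blocks e a = er_blocks E a.
Proof.
rewrite /code_blocks code_head_finEquiv -card_ord_count.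
by apply: eq_card => x; rewrite !inE code_min_finEquiv code_class_finEquiv.
Qed.

Lemma code_rect_finEquiv : code_rect e <-> er_rect E.
Proof.
rewrite /code_rect code_head_finEquiv; split=> [rectE x y|rectE].
  have lt_iota (z : 'I_(er_size E)) : nat_of_ord z \in iota 0 (er_size E).
    by rewrite mem_iota /= add0n.
  have /allP/(_ _ (lt_iota y))/eqP := allP rectE _ (lt_iota x).
  by rewrite !code_class_finEquiv.
apply/allP => i; rewrite mem_iota => /= iE.
apply/allP => j; rewrite mem_iota => /= jE.
have := rectE (Ordinal iE) (Ordinal jE); rewrite -!code_class_finEquiv /= => ->.
by [].
Qed.

End CodeFinEquiv.

Lemma code_le_finEquiv E F :
  code_le (code_finEquiv E) (code_finEquiv F) <-> embeds E F.
Proof.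
rewrite /code_le code_head_finEquiv; split=> [le_EF|EF].
  apply: blocks_embeds => a _; case: (ltnP (er_size E) a) => [lt_a|le_a].
    by rewrite er_blocks_gt_size.
  by rewrite -!code_blocks_finEquiv; apply: (allP le_EF); rewrite mem_iota.
by apply/allP => a _; rewrite !code_blocks_finEquiv; apply: embeds_blocks.
Qed.

Lemma code_decideP (B : seq finEquiv) : code_decide (code_basis B) <->
  forall b, List.In b B -> exists r, [/\ List.In r B, er_rect r & embeds r b].
Proof.
(* Membership becomes a position in the list, which is what [code_decide] quantifies over. *)
have InP (T : Type) (x : T) s :
    List.In x s <-> exists2 i, i < size s & nth x s i = x.
  elim: s => [|y s [IH1 IH2]] /=; first by split=> // -[].
  split=> [[->|/IH1[i ? ?]]|[[|i] /= lti xE]];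
    [by exists 0 | by exists i.+1 | by left |].
  by right; apply: IH2; exists i.
have nthE b i : i < size B ->
    code_nth (code_basis B) i = code_finEquiv (nth b B i).
  by move=> iB; rewrite code_nthE (nth_map b).
rewrite /code_decide code_sizeE size_map; split=> [decB b bB|rectB].
  have [i iB bE] := (InP _ b B).1 bB.
  have i_iota : i \in iota 0 (size B) by rewrite mem_iota.
  have /hasP[j] := allP decB i i_iota.
  rewrite mem_iota add0n => /= jB.
  rewrite !(nthE b) // bE.
  move=> /andP[/code_rect_finEquiv r_rect /code_le_finEquiv rb].
  by exists (nth b B j); split=> //; apply/InP; exists j => //;
    apply: set_nth_default.
apply/allP => i; rewrite mem_iota add0n => /= iB.
(* A default for [nth]; the list is nonempty because i is a valid index. *)
have [b0 _] : exists b : finEquiv, True by case: (B) iB => // b; exists b.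
have [|r [rB r_rect rb]] := rectB (nth b0 B i).
  by apply/InP; exists i => //; apply: set_nth_default.
have [j jB rE] := (InP _ r B).1 rB.
apply/hasP; exists j; first by rewrite mem_iota.
rewrite (nthE b0 i) // (nthE r j) // rE.
by apply/andP; split; [apply/code_rect_finEquiv|apply/code_le_finEquiv].
Qed.

Local Open Scope classical_set_scope.

Theorem theorem4p5 :
  recursively_decidable code_basis
    (fun B : seq finEquiv => atomic (Av [set x | List.In x B])).
Proof.
have [f fP] := computable_decide.
exists f => B; exists (code_decide (code_basis B)).
split; first exact: (fP [tuple code_basis B]).
rewrite code_decideP; split; [exact: rect_of_atomic|exact: atomic_of_rect].
Qed.
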